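(* Let $D=(V,A)$ be a weak path on $n\ge 1$ vertices, with vertices labeled in order from one end-vertex to the other as $v_1,v_2,\dots,v_n$. Let $$V_-=\{v_1\}\cup\{v_k: (v_k,v_{k-1})\in A\text{ and }(v_{k-1},v_k)\notin A\},$$ $$V_+=\{v_n\}\cup\{v_k: (v_k,v_{k+1})\in A\text{ and }(v_{k+1},v_k)\notin A\},$$ and let $\ell=\min\{i-j: v_j\in V_-,\ v_i\in V_+,\ i-j\ge 0\}$. Then $$F(D)=n-1-\left\lceil\frac{\ell}{2}\right\rceil.$$
   Context: A finite simple digraph $D=(V,A)$ has finite nonempty vertex set $V$ and arc set $A$ consisting of ordered pairs of distinct vertices (no loops, no parallel arcs; both $(u,v)$ and $(v,u)$ may be present). $N_D^+(v)=\{u:(v,u)\in A\}$. A weak path is a digraph whose underlying undirected graph (replace each arc $(u,v)$ by the edge $\{u,v\}$) is a path; thus consecutive vertices $v_i,v_{i+1}$ are joined by one or both of the arcs $(v_i,v_{i+1}),(v_{i+1},v_i)$, and there are no other arcs. The single vertex $K_1$ and digraphs with underlying graph $K_2$ are included. Zero forcing: for $S\subseteq V$ let $B^0(S)=S$ and $B^{i+1}(S)=B^i(S)\cup\{w:\{w\}=N_D^+(v)\setminus B^i(S)\text{ for some }v\in B^i(S)\}$. $S$ is a zero forcing set (ZFS) if $B^t(S)=V$ for some $t\ge 0$, and a failed zero forcing set (FZFS) otherwise. The failed zero forcing number $F(D)$ is the largest cardinality of an FZFS of $D$. *)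

(* Defs.v *)
From mathcomp Require Import all_boot.
From mathcomp Require Import boolp.

Set Implicit Arguments.
Unset Strict Implicit.
Unset Printing Implicit Defensive.

(* A finite simple digraph is an irreflexive arc relation [A] on a finite type
   of vertices; [A x y] means that (x, y) is an arc. *)

Section ZeroForcing.
Variables (V : finType) (A : rel V).

Definition out_nbrs (x : V) : {set V} := [set y | A x y].

Definition force_step (B : {set V}) : {set V} :=
  B :|: [set w | [exists x in B, [set w] == out_nbrs x :\: B]].

Definition zero_forcing_set (S : {set V}) : Prop :=
  exists t : nat, iter t force_step S = [set: V].

Definition failed_zero_forcing_set (S : {set V}) : Prop :=
  ~ zero_forcing_set S.

(* If V is nonempty, set0 is a failed zero forcing set, so the maximum is over
   a nonempty family. *)
Definition failed_zero_forcing_number : nat :=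
  \max_(S : {set V} | `[< failed_zero_forcing_set S >]) #|S|.

Definition underlying : rel V := fun x y => A x y || A y x.

End ZeroForcing.

Section WeakPath.
Variables (V : finType) (A : rel V) (n : nat) (v : 'I_n -> V).

(* The labels are shifted by one: v_1, ..., v_n are [v] at 0, ..., n - 1. *)
Definition weak_path_labelling : Prop :=
  bijective v /\
  forall i j : 'I_n,
    underlying A (v i) (v j) = (i.+1 == j :> nat) || (j.+1 == i :> nat).

Definition V_minus : {set V} :=
  [set v k | k : 'I_n &
    (k == 0 :> nat) ||
    [exists j : 'I_n,
      [&& j.+1 == k :> nat, A (v k) (v j) & ~~ A (v j) (v k)]]].

Definition V_plus : {set V} :=
  [set v k | k : 'I_n &
    (k.+1 == n) ||
    [exists j : 'I_n,
      [&& k.+1 == j :> nat, A (v k) (v j) & ~~ A (v j) (v k)]]].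

Definition is_gap (m : nat) : bool :=
  [exists j : 'I_n, exists i : 'I_n,
    [&& v j \in V_minus, v i \in V_plus, j <= i & m == i - j]].

Lemma ex_gap : 0 < n -> exists m, is_gap m.
Proof.
move=> n_gt0; have n1 : n.-1 < n by rewrite prednK.
exists n.-1; apply/existsP; exists (Ordinal n_gt0).
apply/existsP; exists (Ordinal n1); apply/and4P; split => //=.
- by apply/imsetP; exists (Ordinal n_gt0); rewrite ?inE.
- by apply/imsetP; exists (Ordinal n1); rewrite ?inE ?prednK ?eqxx.
- by rewrite subn0.
Qed.

Definition min_gap (n_gt0 : 0 < n) : nat := ex_minn (ex_gap n_gt0).

End WeakPath.

(* Main.v *)
Require Import Defs.
From mathcomp Require Import all_boot.
From mathcomp Require Import boolp zify.

Set Implicit Arguments.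
Unset Strict Implicit.
Unset Printing Implicit Defensive.

(** A maximum failed zero forcing set is stalled, so [F(D) = |V| - min |W|]
    over the nonempty [W] such that no vertex outside [W] has exactly one
    out-neighbour in [W].  On a weak path the first vertex of such a [W] lies
    in [V_-] and the last one in [V_+]; from the first vertex of [W] up to the
    first vertex of [W] in [V_+], two successive elements of [W] are at
    distance at most 2, which forces [2|W| >= l + 2].  Conversely, for a
    closest pair [v_j], [v_i], minimality makes every arc between [v_j] and
    [v_i] bidirected, and [W = {v_j, v_(j+2), ...} U {v_i}] is such a set. *)

(** * Stalled sets and forts in arbitrary digraphs *)

Definition white_fort (V : finType) (A : rel V) (W : {set V}) : Prop :=
  W != set0 /\ forall x, x \notin W -> #|out_nbrs A x :&: W| != 1.

Lemma force_step_fixP (V : finType) (A : rel V) (S : {set V}) :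
  force_step A S = S <-> forall x, x \in S -> #|out_nbrs A x :\: S| != 1.
Proof.
split=> [fixS x xS | stalled].
  apply/negP => /cards1P [w Nw].
  have: w \in out_nbrs A x :\: S by rewrite Nw inE.
  rewrite inE => /andP[/negP wS _]; apply: wS.
  rewrite -fixS !inE; apply/orP; right.
  by apply/existsP; exists x; rewrite xS Nw eqxx.
apply/setUidPl/subsetP => w; rewrite inE => /existsP[x /andP[xS /eqP Nw]].
by have := stalled x xS; rewrite -Nw cards1.
Qed.

Lemma sub_stalled_failed (V : finType) (A : rel V) (S : {set V}) :
  force_step A S = S -> S != setT -> failed_zero_forcing_set A S.
Proof.
move=> fixS nT [t]; have -> : iter t (force_step A) S = S.
  by elim: t => //= t ->.
by move/eqP; rewrite (negbTE nT).
Qed.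

Lemma white_fort_stalled (V : finType) (A : rel V) (S : {set V}) :
  white_fort A (~: S) <-> force_step A S = S /\ S != setT.
Proof.
have nzE : (~: S != set0) = (S != setT) by rewrite -setCT (inj_eq (@setC_inj V)).
rewrite /white_fort nzE force_step_fixP; split.
  move=> [nT H]; split=> // x xS.
  by rewrite setDE; apply: H; rewrite inE negbK.
move=> [H nT]; split=> // x; rewrite inE negbK => xS.
by rewrite -setDE; apply: H.
Qed.

Lemma failed_zero_forcing_number_ge (V : finType) (A : rel V) (W : {set V}) :
  white_fort A W -> #|V| - #|W| <= failed_zero_forcing_number A.
Proof.
rewrite -{1}[W]setCK => /white_fort_stalled [fixS nT].
have -> : #|V| - #|W| = #|~: W| by have := cardsC W; lia.
apply: (leq_bigmax_cond (F := fun S : {set V} => #|S|)).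
by apply/asboolP/sub_stalled_failed.
Qed.

(** A failed set of maximum size is stalled, since a forcing step would otherwise enlarge it to
    another failed set. Nonemptiness of [V] makes [set0] failed, so the maximum is attained. *)
Lemma failed_zero_forcing_number_fort (V : finType) (A : rel V) :
  0 < #|V| ->
  exists2 W, white_fort A W & failed_zero_forcing_number A = #|V| - #|W|.
Proof.
move=> V_gt0; have fort0 : `[< failed_zero_forcing_set A set0 >].
  apply/asboolP/sub_stalled_failed.
    by apply/force_step_fixP => x; rewrite inE.
  by apply: contraTneq V_gt0 => E; rewrite -cardsT -E cards0.
rewrite /failed_zero_forcing_number (bigmax_eq_arg set0) //.
case: arg_maxnP => // S /asboolP failS maxS.
exists (~: S); last by have := cardsC S; lia.
apply/white_fort_stalled; split; last first.
  by apply/eqP => ST; apply: failS; exists 0.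
have sub : S \subset force_step A S by apply: subsetUl.
apply/esym/eqP; rewrite eqEcard sub; apply: maxS.
(* If [force_step A S] filled the graph in [t] steps, [S] would do so in [t.+1]. *)
by apply/asboolP => -[t Et]; apply: failS; exists t.+1; rewrite iterSr.
Qed.

Lemma white_fort_second (V : finType) (A : rel V) (W : {set V}) x y :
  white_fort A W -> x \notin W -> y \in W -> A x y ->
  exists z, [/\ z != y, z \in W & A x z].
Proof.
move=> [_ H] xW yW Axy.
case: (pickP [pred z | [&& z != y, z \in W & A x z]]) => [z /and3P[]|none].
  by exists z.
have := H x xW; suff -> : out_nbrs A x :&: W = [set y] by rewrite cards1.
apply/setP => z; rewrite !inE; have := none z => /=.
by case: eqVneq => [-> _ | _]; [rewrite Axy yW | case: (z \in W); case: (A x z)].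
Qed.

(** Both ends satisfy [w], and no two successive positions between them both fail it. *)
Lemma sum_gap2_ge (w : pred nat) a i : a <= i -> w a -> w i ->
  (forall k, a <= k < i -> w k -> w k.+1 || w k.+2) ->
  i - a + 2 <= 2 * \sum_(a <= k < i.+1) w k.
Proof.
move=> le_ai wa wi gap2.
have pair d : a + d < i -> w (a + d) || w (a + d).+1.
  elim: d => [|d IH] lt_di; first by rewrite addn0 wa.
  rewrite addnS; have := IH; have := gap2 (a + d); case: (w (a + d)) => /=.
    by move=> H _; apply: H => //; lia.
  by move=> _ H; rewrite H //; lia.
(* The extra term [w (a + d)] is a credit for ending on an element: it pays for one missed position
   right after. *)
have partial d : a + d <= i ->
    d + 1 + w (a + d) <= 2 * \sum_(a <= k < (a + d).+1) w k.
  elim: d => [|d IH] le_di; first by rewrite addn0 big_nat1 wa.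
  rewrite (addnS a) big_nat_recr /=; last lia.
  have := IH ltac:(lia); have := pair d ltac:(lia).
  move: (\sum_(_ <= _ < _) _) => s.
  by case: (w (a + d)); case: (w (a + d).+1) => //=; lia.
by have := partial (i - a) ltac:(lia); rewrite subnKC // wi; lia.
Qed.

(** * The path indexed by natural numbers *)

(* Natural number indexing of the path; junk (some vertex) for [k > n]. *)
Definition pvert (V : finType) n (v : 'I_n.+1 -> V) (k : nat) : V := v (inord k).

Lemma pvert_ord (V : finType) n (v : 'I_n.+1 -> V) (k : 'I_n.+1) :
  pvert v k = v k.
Proof. by rewrite /pvert inord_val. Qed.

Lemma pvert_inj (V : finType) (A : rel V) n (v : 'I_n.+1 -> V) i j :
  weak_path_labelling A v -> i <= n -> j <= n -> pvert v i = pvert v j -> i = j.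
Proof.
move=> [/bij_inj v_inj _] le_i le_j /v_inj /(congr1 val).
by rewrite /= !inordK.
Qed.

Lemma pvert_surj (V : finType) (A : rel V) n (v : 'I_n.+1 -> V) x :
  weak_path_labelling A v -> exists2 k, k <= n & x = pvert v k.
Proof.
move=> [[g _ gK] _]; exists (g x); first by rewrite -ltnS.
by rewrite pvert_ord gK.
Qed.

Lemma pvert_adj (V : finType) (A : rel V) n (v : 'I_n.+1 -> V) i j :
  weak_path_labelling A v -> i <= n -> j <= n ->
  A (pvert v i) (pvert v j) || A (pvert v j) (pvert v i)
  = (i.+1 == j) || (j.+1 == i).
Proof.
by move=> [_ adj] le_i le_j; have := adj (inord i) (inord j); rewrite !inordK.
Qed.

(** Successive vertices are joined by some arc, so absence of the forward arc already yields the
    backward one. *)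
Lemma mem_V_minus (V : finType) (A : rel V) n (v : 'I_n.+1 -> V) k :
  weak_path_labelling A v -> k <= n ->
  (pvert v k \in V_minus A v) = (k == 0) || ~~ A (pvert v k.-1) (pvert v k).
Proof.
move=> vP le_kn; have [/bij_inj v_inj _] := vP.
rewrite {1}/pvert mem_imset // inE inordK //; case: k le_kn => //= k lt_kn.
have := @pvert_adj _ A _ v k k.+1 vP (ltnW lt_kn) lt_kn.
rewrite eqxx /= => adj; apply/existsP/idP => [[j] | nA].
  by rewrite eqSS => /and3P[/eqP jk _]; rewrite -jk pvert_ord.
exists (inord k); rewrite inordK ?eqxx //=; last lia.
by move: adj; rewrite /pvert in nA *; rewrite (negbTE nA) /= => ->.
Qed.

Lemma mem_V_plus (V : finType) (A : rel V) n (v : 'I_n.+1 -> V) k :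
  weak_path_labelling A v -> k <= n ->
  (pvert v k \in V_plus A v) = (k == n) || ~~ A (pvert v k.+1) (pvert v k).
Proof.
move=> vP le_kn; have [/bij_inj v_inj _] := vP.
rewrite {1}/pvert mem_imset // inE inordK // eqSS; case: eqVneq => //= ne_kn.
have lt_kn : k.+1 <= n by lia.
have := @pvert_adj _ A _ v k k.+1 vP le_kn lt_kn.
rewrite eqxx /= => adj; apply/existsP/idP => [[j] | nA].
  by move=> /and3P[/eqP jk _]; rewrite jk pvert_ord.
exists (inord k.+1); rewrite inordK ?eqxx //=.
by move: adj; rewrite /pvert in nA *; rewrite (negbTE nA) orbF => ->.
Qed.

Lemma is_gapP (V : finType) (A : rel V) n (v : 'I_n.+1 -> V) m :
  reflect (exists j i, [/\ j <= i <= n, pvert v j \in V_minus A v,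
                           pvert v i \in V_plus A v & m = i - j])
          (is_gap A v m).
Proof.
apply: (iffP existsP) => [[j /existsP[i /and4P[jm ip le_ji /eqP ->]]] |].
  exists j, i; rewrite !pvert_ord; split=> //.
  by rewrite le_ji -ltnS ltn_ord.
move=> [j [i [/andP[le_ji le_in] jm ip ->]]].
exists (inord j); apply/existsP; exists (inord i).
have le_jn := leq_trans le_ji le_in.
by apply/and4P; split; rewrite ?inordK.
Qed.

Lemma card_pvert (V : finType) (A : rel V) n (v : 'I_n.+1 -> V) (W : {set V}) :
  weak_path_labelling A v ->
  #|W| = \sum_(0 <= k < n.+1) (pvert v k \in W).
Proof.
move=> [v_bij _]; rewrite big_mkord -sum1_card big_mkcond /=.
rewrite (reindex v) /=; last exact: onW_bij.
by apply: eq_bigr => k _; rewrite pvert_ord; case: (v k \in W).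
Qed.

(** * Every fort is large *)

Lemma white_fort_nbr (V : finType) (A : rel V) n (v : 'I_n.+1 -> V)
    (W : {set V}) k l :
  weak_path_labelling A v -> white_fort A W -> k <= n -> l <= n ->
  pvert v k \notin W -> pvert v l \in W -> A (pvert v k) (pvert v l) ->
  exists m, [/\ m <= n, m != l, (k.+1 == m) || (m.+1 == k) & pvert v m \in W].
Proof.
move=> vP fortW le_k le_l kW lW Akl.
have [z [zl zW Akz]] := white_fort_second fortW kW lW Akl.
have [m le_m zE] := pvert_surj z vP; rewrite {}zE in zl zW Akz.
exists m; split=> //; first by apply: contraNneq zl => ->.
by rewrite -(pvert_adj vP) // Akz.
Qed.

Lemma white_fort_gap (V : finType) (A : rel V) n (v : 'I_n.+1 -> V)
    (W : {set V}) :
  weak_path_labelling A v -> white_fort A W ->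
  exists2 m, is_gap A v m & m + 2 <= 2 * #|W|.
Proof.
move=> vP fortW; pose w k := (k <= n) && (pvert v k \in W).
have w_ex : exists k, w k.
  have [/set0Pn[x xW] _] := fortW; have [k le_k xE] := pvert_surj x vP.
  by exists k; rewrite /w le_k -xE.
have w_bound k : w k -> k <= n by case/andP.
(* Outside [V_plus], vertex [k] receives an arc from [k.+1]; if [k.+1] is not in [W], its second
   out-neighbour in [W] can only be [k.+2]. *)
have gap2 k : w k -> pvert v k \notin V_plus A v -> w k.+1 || w k.+2.
  move=> /andP[le_k kW]; rewrite mem_V_plus // negb_or negbK => /andP[ne_kn Ak].
  have lt_kn : k.+1 <= n by lia.
  case: (boolP (w k.+1)) => //=; rewrite /w lt_kn /= => k1W.
  have [m [le_m ne_mk adj mW]] := white_fort_nbr vP fortW lt_kn le_k k1W kW Ak.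
  have -> : k.+2 = m by lia.
  by rewrite le_m.
case: (ex_minnP w_ex) => a wa a_min.
have a_minus : pvert v a \in V_minus A v.
  have /andP[le_a aW] := wa; rewrite mem_V_minus //.
  (* An arc from [a.-1] to [a] would put the other neighbour of [a.-1] in [W], below the minimum
     [a]. *)
  case: (posnP a) => //= a_gt0; apply/negP => Aa.
  have aW1 : pvert v a.-1 \notin W.
    by apply/negP => W1; have := a_min a.-1; rewrite /w W1 andbT; lia.
  have [m [le_m ne_ma adj mW]] :=
    white_fort_nbr vP fortW (ltac:(lia) : a.-1 <= n) le_a aW1 aW Aa.
  by have := a_min m; rewrite /w le_m mW; lia.
(* The last index of [W] qualifies, by [gap2]. Taking the least such [i] keeps the elements of [W]
   from [a] up to [i] out of [V_plus], so [gap2] applies to each. *)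
pose e i := [&& a <= i, w i & pvert v i \in V_plus A v].
have e_ex : exists i, e i.
  case: (ex_maxnP w_ex w_bound) => i wi i_max; exists i; apply/and3P; split=> //.
    exact: i_max.
  by apply/negPn/negP => /(gap2 _ wi) /orP[] /i_max; lia.
case: (ex_minnP e_ex) => i /and3P[le_ai wi i_plus] i_min.
exists (i - a).
  by apply/is_gapP; exists a, i; rewrite le_ai w_bound.
have step k : a <= k < i -> w k -> w k.+1 || w k.+2.
  move=> /andP[le_ak lt_ki] wk; apply: gap2 => //; apply/negP => k_plus.
  by have := i_min k; rewrite /e le_ak wk k_plus; lia.
have := sum_gap2_ge le_ai wa wi step; move=> /leq_trans; apply.
have le_in := w_bound _ wi.
rewrite leq_mul2l (card_pvert W vP) /=.
rewrite (@big_cat_nat _ _ _ a 0 n.+1) //=; last lia.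
rewrite (@big_cat_nat _ _ _ i.+1 a n.+1) //=; last lia.
apply: leq_trans (leq_addl _ _); apply: leq_trans (leq_addr _ _).
by apply: leq_sum => k _; rewrite /w; case: (k <= n).
Qed.

(** * A fort of optimal size, and the formula *)

Lemma min_gap_white_fort (V : finType) (A : rel V) n (v : 'I_n.+1 -> V) l :
  weak_path_labelling A v -> is_gap A v l ->
  (forall m, is_gap A v m -> l <= m) ->
  exists2 W, white_fort A W & #|W| <= (uphalf l).+1.
Proof.
move=> vP /is_gapP[j [i [/andP[le_ji le_in] j_minus i_plus lE]]] l_min.
(* A missing arc would put [k] in [V_plus], closer to [j] than [i] is; [left] is symmetric, with
   [k.+1] in [V_minus]. *)
have right k : j <= k < i -> A (pvert v k.+1) (pvert v k).
  move=> /andP[le_jk lt_ki]; apply/negPn/negP => nA.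
  have /l_min : is_gap A v (k - j); last lia.
  apply/is_gapP; exists j, k; split=> //; first lia.
  by rewrite mem_V_plus ?nA ?orbT //; lia.
have left k : j <= k < i -> A (pvert v k) (pvert v k.+1).
  move=> /andP[le_jk lt_ki]; apply/negPn/negP => nA.
  have /l_min : is_gap A v (i - k.+1); last lia.
  apply/is_gapP; exists k.+1, i; split=> //; first lia.
  by rewrite mem_V_minus ?nA ?orbT //; lia.
(* Steps of 2 from [j]; [minn] shortens the last one to 1 when [l] is odd. *)
pose f (m : 'I_(uphalf l).+1) := minn (j + 2 * m) i.
pose W := [set pvert v (f m) | m : 'I_(uphalf l).+1].
have memW k : k <= n ->
    (pvert v k \in W) = (j <= k <= i) && (~~ odd (k - j) || (k == i)).
  move=> le_k; apply/imsetP/idP => [[m _] | kji].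
    move/(pvert_inj vP le_k); rewrite /f => -> //; last lia.
    have := ltn_ord m; lia.
  have lt_m : uphalf (k - j) < (uphalf l).+1 by lia.
  exists (Ordinal lt_m) => //; congr pvert; rewrite /f /=; lia.
exists W; last first.
  by apply: leq_trans (leq_imset_card _ _) _; rewrite card_ord.
split.
  by apply/set0Pn; exists (pvert v i); rewrite memW // leqnn le_ji eqxx orbT.
move=> x; have [k le_k ->] := pvert_surj x vP; rewrite memW // => kW.
case: (boolP (j < k < i)) => [k_in | k_out].
  (* Here [k - j] is odd, so both neighbours of [k] lie in [W], and both are out-neighbours by
     [right] and [left]. *)
  have sub : [set pvert v k.-1; pvert v k.+1]
             \subset out_nbrs A (pvert v k) :&: W.
    apply/subsetP => y /set2P[] ->; rewrite !inE memW; try lia.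
      have := right k.-1; rewrite prednK; last lia.
      by move=> ->; lia.
    by rewrite left; lia.
  have := subset_leq_card sub; rewrite cards2.
  case: eqVneq => [/(pvert_inj vP)|_ /=]; first by lia.
  by move=> ?; apply/eqP; lia.
(* Now [k < j] or [i < k]. Only [j] or [i] could be reached in [W], and membership in [V_minus] or
   [V_plus] excludes that arc. *)
suff -> : out_nbrs A (pvert v k) :&: W = set0 by rewrite cards0.
apply/setP => y; rewrite !inE; have [m le_m ->] := pvert_surj y vP.
rewrite memW //; apply/negP => /andP[Akm mW].
have := pvert_adj vP le_k le_m; rewrite Akm /= => /esym/orP[/eqP mE | /eqP mE].
  have mj : m = j by lia.
  move: j_minus; rewrite mem_V_minus //; last lia.
  by rewrite -mj -mE /= mE Akm.
have mi : m = i by lia.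
move: i_plus; rewrite mem_V_plus // -mi mE Akm; lia.
Qed.

Theorem theorem4p5 (V : finType) (A : rel V) (n : nat) (v : 'I_n -> V)
    (A_irrefl : irreflexive A) (n_gt0 : 0 < n)
    (v_path : weak_path_labelling A v) :
  failed_zero_forcing_number A = n - 1 - uphalf (min_gap A v n_gt0).
Proof.
case: n v n_gt0 v_path => // n v n_gt0 v_path.
have cardV : #|V| = n.+1.
  by have [v_bij _] := v_path; rewrite -(bij_eq_card v_bij) card_ord.
rewrite /min_gap; case: ex_minnP => l l_gap l_min.
(* From [l + 2 <= 2 * #|W|] follows [uphalf l + 1 <= #|W|], the size that the construction
   attains. *)
apply/eqP; rewrite eqn_leq; apply/andP; split.
  have [|W fortW ->] := @failed_zero_forcing_number_fort _ A; first by rewrite cardV.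
  have [m /l_min le_lm le_mW] := white_fort_gap v_path fortW.
  by rewrite cardV; lia.
have [W fortW leW] := min_gap_white_fort v_path l_gap l_min.
by have := failed_zero_forcing_number_ge fortW; rewrite cardV; lia.
Qed.
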